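(* Let $k$ be a positive real number and let $(A,B_1,\ldots,B_p)$ satisfy conditions (i)–(ii) of the context and be $k$-weakly-coupled. Then, for every $\psi_0\in D(|A|^{k/2})$, $K>0$, $T\ge0$, and every piecewise constant function $u=(u_1,\ldots,u_p)$ for which $\sum_{l=1}^p\|u_l\|_{L^1}\le K$, one has $$\|\Upsilon^u_T(\psi_0)\|_{k/2}\le e^{c_k(A,B_1,\ldots,B_p)K}\,\|\psi_0\|_{k/2}.$$
   Context: $H$ is a separable complex Hilbert space with norm $\|\cdot\|$ and inner product $\langle\cdot,\cdot\rangle$; $\mathbf{N}=\{1,2,\ldots\}$. $(A,B_1,\ldots,B_p)$ is a $(p+1)$-tuple of linear operators in $H$. Conditions: (i) for every $u\in\mathbf{R}^p$, $A+\sum_l u_lB_l$ is essentially skew-adjoint on the domain $D(A)$ of $A$, and $\mathrm{i}(A+\sum_l u_lB_l)$ is bounded from below; (ii) $A$ is skew-adjoint with purely discrete spectrum $(-\mathrm{i}\lambda_j)_{j\in\mathbf{N}}$, where $(\lambda_j)_{j\in\mathbf{N}}$ is positive, non-decreasing and unbounded. $(\phi_j)_{j\in\mathbf{N}}$ is a Hilbert basis of $H$ with $A\phi_j=-\mathrm{i}\lambda_j\phi_j$. $A+\sum_l u_lB_l$ also denotes its skew-adjoint closure, and $D(A+\sum_l u_lB_l)$ is the domain on which it is skew-adjoint. For $s\ge 0$, $D(|A|^s)=\{\psi\in H:\sum_j\lambda_j^{2s}|\langle\phi_j,\psi\rangle|^2<\infty\}$, $|A|^s\psi=\sum_j\lambda_j^s\langle\phi_j,\psi\rangle\phi_j$,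 and $\|\psi\|_s=\||A|^s\psi\|$. Powers of the modulus of other skew-adjoint operators are defined likewise by functional calculus. For $k>0$, $(A,B_1,\ldots,B_p)$ (satisfying (i)) is $k$-weakly-coupled if for every $u\in\mathbf{R}^p$, $D(|A+\sum_l u_lB_l|^{k/2})=D(|A|^{k/2})$, and there is a constant $C$ such that for every $1\le l\le p$ and $\psi\in D(|A|^k)$, $|\Re\langle|A|^k\psi,B_l\psi\rangle|\le C|\langle|A|^k\psi,\psi\rangle|$. The coupling constant is $$c_k(A,B_1,\ldots,B_p)=\sup_{\psi\in D(|A|^k)\setminus\{0\}}\ \sup_{1\le l\le p}\frac{|\Re\langle|A|^k\psi,B_l\psi\rangle|}{|\langle|A|^k\psi,\psi\rangle|}.$$ Propagator: for a piecewise constant $u=\sum_{n=0}^N u^n\chi_{[t_n,t_{n+1})}$ with values in $\mathbf{R}^p$, $0=t_0\le t_1\le\cdots\le t_{N+1}$ (so $u=0$ from $t_{N+1}$ on), $\Upsilon^u_t$ is the unitary operator $$\Upsilon^u_t=e^{(t-t_{j-1})(A+\sum_l u_l^{j-1}B_l)}\circ e^{(t_{j-1}-t_{j-2})(A+\sum_l u_l^{j-2}B_l)}\circ\cdots\circ e^{(t_1-t_0)(A+\sum_l u_l^0B_l)}$$ for $t\in[t_{j-1},t_j)$, extended with control $0$ after $t_{N+1}$; i.e. $t\mapsto\Upsilon^u_t\psi_0$ is the solution of $\frac{d\psi}{dt}=(A+\sum_l u_l(t)B_l)\psi$, $\psi(0)=\psi_0$. *)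

(* Defs.v *)
From mathcomp Require Import all_boot all_order all_algebra.
From mathcomp Require Import sesquilinear complex.
From mathcomp Require Import all_classical all_reals all_analysis.

Set Implicit Arguments.
Unset Strict Implicit.
Unset Printing Implicit Defensive.
Import Order.TTheory GRing.Theory Num.Theory.
Import numFieldNormedType.Exports.

Local Open Scope classical_set_scope.
Local Open Scope ring_scope.
Local Open Scope complex_scope.

Definition separable (T : topologicalType) : Prop :=
  exists2 D : set T, countable D & dense D.

(* A possibly unbounded operator; the values of [app] outside [dom] are
   meaningless and are never used. *)
Record linop (K : numFieldType) (H : normedModType K) := LinOp {
  dom : set H ;
  app :> H -> H ;
  dom_0 : dom 0 ;
  dom_P : forall a x y, dom x -> dom y -> dom (a *: x + y) ;
  app_P : forall a x y, dom x -> dom y -> app (a *: x + y) = a *: app x + app y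
}.

Section Operators.
Context {R : realType} {H : completeNormedModType R[i]}.
Variable dot : {dot H for @Num.conj R[i]}.

(* The inner product is linear in its second argument, whereas the forms of
   the library are linear in the first one. *)
Definition ip (x y : H) : R[i] := dot y x.

Definition inner_product_norm : Prop := forall x : H, `|x| ^+ 2 = ip x x.

Definition rnorm (x : H) : R := complex.Re `|x|.

Definition hilbert_basis (phi : nat -> H) : Prop :=
  (forall i j, ip (phi i) (phi j) = (i == j)%:R) /\
  dense [set x | exists n (c : nat -> R[i]), x = \sum_(j < n) c j *: phi j].

(* From here on, an unbounded operator is identified with its graph; the
   closure of an operator is the topological [closure] of its graph in
   [H * H]. *)

Definition gdom (G : set (H * H)) : set H := fst @` G.

Definition linop_graph (S : linop H) : set (H * H) :=
  [set z | dom S z.1 /\ z.2 = S z.1].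

Definition adjoint (G : set (H * H)) : set (H * H) :=
  [set z | forall w, G w -> ip w.2 z.1 = ip w.1 z.2].

Definition skew_adjoint (G : set (H * H)) : Prop :=
  dense (gdom G) /\ adjoint G = [set z | G (z.1, - z.2)].

Definition ess_skew_adjoint (G : set (H * H)) : Prop := skew_adjoint (closure G).

(* The operator i S is bounded from below, S being the operator of graph G;
   the order of [R[i]] makes the right-hand side real. *)
Definition i_bounded_below (G : set (H * H)) : Prop :=
  exists m : R, forall z, G z -> m%:C * ip z.1 z.1 <= ip z.1 ('i *: z.2).

Definition resolvent_set (G : set (H * H)) : set R[i] :=
  [set z | exists Q : H -> H,
    [/\ linear Q, continuous Q,
        forall y, G (Q y, z *: Q y + y) &
        forall w, G w -> Q (w.2 - z *: w.1) = w.1]].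

Definition spectrum (G : set (H * H)) : set R[i] := ~` resolvent_set G.

Definition finite_multiplicity (G : set (H * H)) (z : R[i]) : Prop :=
  exists n (v : 'I_n -> H), forall x, G (x, z *: x) ->
    exists c : 'I_n -> R[i], x = \sum_(j < n) c j *: v j.

Definition purely_discrete_spectrum (G : set (H * H)) : Prop :=
  forall z, spectrum G z ->
    [/\ exists2 e : R, 0 < e &
          forall w, spectrum G w -> `|w - z| < e%:C -> w = z,
        exists2 x, x != 0 & G (x, z *: x) &
        finite_multiplicity G z].

(* Spectral resolution S = \int i l dE(l) of a skew-adjoint operator S of
   graph G. The operator \int i l dE(l) is determined by its domain together
   with its quadratic form <x, S x> = i \int l d<x, E(l) x>. *)

Definition spectral_measure (E : set R -> H -> H) (x : H) (X : set R) : \bar R :=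
  (complex.Re (ip x (E X x)))%:E.

Definition spectral_resolution (G : set (H * H)) (E : set R -> H -> H) : Prop :=
  [/\ forall X, measurable X ->
        [/\ linear (E X), forall x, E X (E X x) = E X x &
            forall x y, ip (E X x) y = ip x (E X y)],
      forall x, E setT x = x,
      forall F : nat -> set R, (forall n, measurable (F n)) ->
        trivIset setT F -> forall x,
        (fun N => \sum_(n < N) E (F n) x) @ \oo --> E (\bigcup_n F n) x,
      gdom G =
        [set x | (\int[spectral_measure E x]_l (l ^+ 2)%:E < +oo)%E] &
      forall z, G z -> ip z.1 z.2 =
        'i * (fine (\int[spectral_measure E z.1]_l l%:E)%E)%:C].

(* D(|S|^s) for a skew-adjoint operator S of graph G; the spectral resolution
   of S is unique. *)
Definition dom_absop (G : set (H * H)) (s : R) : set H :=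
  [set x | exists2 E, spectral_resolution G E &
    (\int[spectral_measure E x]_l (`|l| `^ (2 * s))%:E < +oo)%E].

(* D(|A|^s), |A|^s and the norm of index s, for A diagonal in the Hilbert
   basis phi with eigenvalues - i lambda_j. *)

Definition dom_abspow (lambda : nat -> R) (phi : nat -> H) (s : R) : set H :=
  [set psi | (\sum_(0 <= j <oo)
    (lambda j `^ (2 * s) * complex.Re `|ip (phi j) psi| ^+ 2)%:E < +oo)%E].

Definition abspow (lambda : nat -> R) (phi : nat -> H) (s : R) (psi : H) : H :=
  limn (series (fun j => ((lambda j `^ s)%:C * ip (phi j) psi) *: phi j)).

Definition norm_s (lambda : nat -> R) (phi : nat -> H) (s : R) (psi : H) : R :=
  rnorm (abspow lambda phi s psi).

(* The tuple (A, B_1, ..., B_p). *)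

Definition control_graph p (A : linop H) (B : 'I_p -> linop H) (u : 'rV[R]_p) :
    set (H * H) :=
  [set z | dom A z.1 /\ z.2 = A z.1 + \sum_(l < p) (u ord0 l)%:C *: B l z.1].

Definition controlled p (A : linop H) (B : 'I_p -> linop H) (u : 'rV[R]_p) :
    set (H * H) := closure (control_graph A B u).

Definition condition_i p (A : linop H) (B : 'I_p -> linop H) : Prop :=
  (forall l, dom A `<=` dom (B l)) /\
  forall u, ess_skew_adjoint (control_graph A B u) /\
            i_bounded_below (control_graph A B u).

Definition condition_ii (A : linop H) (lambda : nat -> R) (phi : nat -> H) :
    Prop :=
  [/\ skew_adjoint (linop_graph A),
      purely_discrete_spectrum (linop_graph A) /\
        spectrum (linop_graph A) = range (fun j => - ('i * (lambda j)%:C)),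
      [/\ forall j, 0 < lambda j,
          {homo lambda : i j / (i <= j)%N >-> i <= j} &
          forall M, exists j, M < lambda j],
      hilbert_basis phi &
      forall j, dom A (phi j) /\ A (phi j) = - ('i * (lambda j)%:C) *: phi j].

(* [|A|^k psi, B_l psi] only makes sense for psi in the domain of B_l, which
   contains D(|A|^k) as soon as k >= 1. *)
Definition coupling_dom p (B : 'I_p -> linop H) (lambda : nat -> R)
    (phi : nat -> H) (k : R) (l : 'I_p) : set H :=
  dom_abspow lambda phi k `&` dom (B l).

Definition weakly_coupled p (A : linop H) (B : 'I_p -> linop H)
    (lambda : nat -> R) (phi : nat -> H) (k : R) : Prop :=
  (forall u, dom_absop (controlled A B u) (k / 2) =
             dom_abspow lambda phi (k / 2)) /\
  exists C : R, forall l psi, coupling_dom B lambda phi k l psi ->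
    `|complex.Re (ip (abspow lambda phi k psi) (B l psi))| <=
    C * complex.Re `|ip (abspow lambda phi k psi) psi|.

Definition coupling_constant p (B : 'I_p -> linop H)
    (lambda : nat -> R) (phi : nat -> H) (k : R) : R :=
  sup [set r | exists psi l, [/\ coupling_dom B lambda phi k l psi, psi != 0 &
    r = `|complex.Re (ip (abspow lambda phi k psi) (B l psi))| /
        complex.Re `|ip (abspow lambda phi k psi) psi|]].

Definition unitary_group (U : R -> H -> H) : Prop :=
  [/\ forall t, linear (U t),
      forall t x, `|U t x| = `|x|,
      forall x, U 0 x = x,
      forall s t x, U (s + t) x = U s (U t x) &
      forall x, U t x @[t --> (0 : R)] --> x].

Definition generator (U : R -> H -> H) : set (H * H) :=
  [set z | (h^-1)%:C *: (U h z.1 - z.1) @[h --> (0 : R)^'] --> z.2].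

(* t |-> e^{t S} for a skew-adjoint operator S of graph G: by Stone's theorem
   the strongly continuous unitary group generated by S exists and is unique,
   so that the default value is irrelevant. *)
Definition op_exp (G : set (H * H)) : R -> H -> H :=
  xget ((fun _ x => x) : R -> H -> H) [set U : R -> H -> H | unitary_group U /\ generator U = G].

End Operators.

(* u = \sum_(n <= N) level n * chi_[knot n, knot n.+1[ *)
Record pcontrol (R : realType) (p : nat) := PControl {
  last_step : nat ;
  knot : nat -> R ;
  level : nat -> 'rV[R]_p ;
  knot_0 : knot 0%N = 0 ;
  knot_le : forall n, (n <= last_step)%N -> knot n <= knot n.+1
}.

Definition pcontrol_fun (R : realType) (p : nat) (u : pcontrol R p) (s : R) :
    'rV[R]_p :=
  \sum_(n < (last_step u).+1)
    \1_(`[knot u n, knot u n.+1[%classic : set R) s *: level u n.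

Section Propagator.
Context {R : realType} {H : completeNormedModType R[i]}.
Context (p : nat) (A : linop H) (B : 'I_p -> linop H) (u : pcontrol R p).

(* The propagator from time 0 to time min(T, knot n): the steps that begin
   after T have length 0, and the step containing T is cut at T. *)
Fixpoint propagator_steps (T : R) (n : nat) (psi : H) : H :=
  if n is m.+1 then
    op_exp (controlled A B (level u m))
      (Num.min T (knot u m.+1) - Num.min T (knot u m))
      (propagator_steps T m psi)
  else psi.

Definition propagator (T : R) (psi : H) : H :=
  op_exp (controlled A B 0) (T - Num.min T (knot u (last_step u).+1))
    (propagator_steps T (last_step u).+1 psi).

End Propagator.

(* Main.v *)
Require Import Defs.
From mathcomp Require Import all_boot all_order all_algebra.
From mathcomp Require Import sesquilinear complex.
From mathcomp Require Import all_classical all_reals all_analysis.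
From mathcomp Require Import measurable_realfun ring lra.

Set Implicit Arguments.
Unset Strict Implicit.
Unset Printing Implicit Defensive.
Import Order.TTheory GRing.Theory Num.Theory.
Import numFieldNormedType.Exports.

Local Open Scope classical_set_scope.
Local Open Scope ring_scope.
Local Open Scope complex_scope.

(** Write N = |A|^k and S = A + sum_l v_l B_l for a constant control v. Formally
    the proof is one line: along the flow of S,
      d/dt <N psi, psi> = 2 Re <N psi, S psi> = 2 sum_l v_l Re <N psi, B_l psi>
                        <= 2 c_k (sum_l |v_l|) <N psi, psi>,
    because Re <N psi, A psi> = 0, and Gronwall's lemma, applied on each interval
    where the control is constant, produces the exponential of c_k times the L1
    norm of the control. The difficulty is that the flow of S has no reason to
    preserve the domains of N and A, so that none of these terms need make sense.

    The remedy is to replace N by the bounded operator N_e = N (1 + e N)^-1, with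
    e > 0, and to observe that the estimate survives with the same constant
    ([energy_dom]). Let x be in the domain of A and chi = (1 + e N)^-1 x. Then
    N_e x = N chi and x = chi + e N chi, whence
      Re <N_e x, S x> = Re <N chi, S chi> + e Re <N chi, S N chi>.
    The last term is 0 since S is skew-symmetric, and chi is regular enough for
    the coupling inequality; moreover <N chi, chi> <= <N_e x, x>. As N_e is
    bounded, the inequality extends to the closure of S, which generates the
    group; differentiating along the group and integrating gives the bound for
    the energy <N_e psi, psi> from every initial vector ([group_energy],
    [energy_step]). Letting e tend to 0 in finite partial sums shows that the
    domain of |A|^(k/2) is preserved and that the norm grows as claimed
    ([group_step]). The steps are then chained ([propagator_steps_bound]) and
    their lengths summed to the L1 norm of the control ([pcontrol_L1]).

    Functions of A are handled through Fourier coefficients in the eigenbasis: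
    Riesz-Fischer ([comb_cvg]) defines them and Parseval ([parseval]) compares
    the inner products. *)

(** * Complex numbers and closures *)

Section Complex.
Context {R : realType}.
Implicit Types a b : R[i].

Lemma conj_conjc a : Num.conj a = conjc a. Proof. by []. Qed.

Lemma Re_mulc a b :
  complex.Re (a * b) = complex.Re a * complex.Re b - complex.Im a * complex.Im b.
Proof. by case: a b => [a a'] [b b']. Qed.

Lemma Re_addc a b : complex.Re (a + b) = complex.Re a + complex.Re b.
Proof. by case: a b => [a a'] [b b']. Qed.

Lemma Re_norm_ge0 a : 0 <= complex.Re `|a|.
Proof. by rewrite normc_def/= sqrtr_ge0. Qed.

Definition normsq a : R := complex.Re a ^+ 2 + complex.Im a ^+ 2.

Lemma normsq_ge0 a : 0 <= normsq a.
Proof. by rewrite addr_ge0 ?sqr_ge0. Qed.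

Lemma normsqZ (s : R) a : normsq (s%:C * a) = s ^+ 2 * normsq a.
Proof. by case: a => a b; rewrite /normsq/=; ring. Qed.

Lemma normsq_norm a : complex.Re `|a| ^+ 2 = normsq a.
Proof. by rewrite normc_def/= sqr_sqrtr// addr_ge0 ?sqr_ge0. Qed.

Lemma Re_conjcM a : complex.Re (conjc a * a) = normsq a.
Proof. by case: a => a b; rewrite /normsq/=; ring. Qed.

Lemma Re_conjcZ (s : R) a b :
  complex.Re (conjc (s%:C * a) * b) = s * complex.Re (conjc a * b).
Proof. by case: a b => [a a'] [b b']; rewrite /=; ring. Qed.
End Complex.

(** Carries an inequality from a set where it can be computed (the domain of A,
    the span of the basis, the domain of a generator) to limits of its points. *)
Lemma closure_le (R : realType) (T : topologicalType) (E : set T) (f g : T -> R) p :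
  {for p, continuous f} -> {for p, continuous g} ->
  (forall q, E q -> f q <= g q) -> closure E p -> f p <= g p.
Proof.
move=> cf cg fg Ep; rewrite leNgt; apply/negP => gf.
have [q [Eq]] : (E `&` [set q | g q < f q]) !=set0.
  apply: Ep; near=> q; rewrite /= -subr_gt0; near: q.
  have : (f q - g q) @[q --> p] --> f p - g p by apply: cvgB.
  by move/cvgr_gt; apply; rewrite subr_gt0.
by rewrite /= ltNge fg.
Unshelve. all: end_near. Qed.

Lemma dense_closure (T : topologicalType) (E : set T) p : dense E -> closure E p.
Proof.
move=> dE B; rewrite nbhsE => -[U [oU Up] UB].
have [|q [Uq Eq]] := dE U _ oU; first by exists p.
by exists q; split=> //; apply: UB.
Qed.

(** * The inner product *)

Section InnerProduct.
Context {R : realType} {H : completeNormedModType R[i]}.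
Variable dot : {dot H for @Num.conj R[i]}.
Implicit Types (x y z : H) (a : R[i]).

Lemma ipDr x y z : ip dot x (y + z) = ip dot x y + ip dot x z.
Proof. by rewrite /ip linearDl. Qed.

Lemma ipZr x a y : ip dot x (a *: y) = a * ip dot x y.
Proof. by rewrite /ip linearZl_LR. Qed.

Lemma ipC x y : ip dot y x = Num.conj (ip dot x y).
Proof. by rewrite /ip hermC expr0 mul1r. Qed.

Lemma ipZl x a y : ip dot (a *: y) x = Num.conj a * ip dot y x.
Proof. by rewrite ipC ipZr rmorphM [ip dot y x]ipC. Qed.

Lemma ip0r x : ip dot x 0 = 0.
Proof. by rewrite -(scale0r (0 : H)) ipZr mul0r. Qed.

Lemma ipNr x y : ip dot x (- y) = - ip dot x y.
Proof. by rewrite -scaleN1r ipZr mulN1r. Qed.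

Lemma ip_sumr x n (F : nat -> H) :
  ip dot x (\sum_(0 <= j < n) F j) = \sum_(0 <= j < n) ip dot x (F j).
Proof.
elim: n => [|n IH]; first by rewrite !big_geq// ip0r.
by rewrite !big_nat_recr//= ipDr IH.
Qed.

(** The real inner product underlying the complex one. The energy estimates are
    real, and two complex inner products are compared through [rip] alone
    because their imaginary parts are [rip] at a rotated vector. *)
Definition rip x y : R := complex.Re (ip dot x y).

Lemma ripC x y : rip x y = rip y x.
Proof. by rewrite /rip [ip dot y x]ipC conj_conjc; case: (ip _ _ _). Qed.

Lemma ripDr x y z : rip x (y + z) = rip x y + rip x z.
Proof. by rewrite /rip ipDr Re_addc. Qed.

Lemma ripZr x (r : R) y : rip x (r%:C *: y) = r * rip x y.
Proof. by rewrite /rip ipZr Re_mulc /= mul0r subr0. Qed.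

Lemma ripNr x y : rip x (- y) = - rip x y.
Proof. by rewrite /rip ipNr; case: (ip _ _ _). Qed.

Lemma ripBr x y z : rip x (y - z) = rip x y - rip x z.
Proof. by rewrite ripDr ripNr. Qed.

Lemma ripDl x y z : rip (y + z) x = rip y x + rip z x.
Proof. by rewrite ripC ripDr ![rip x _]ripC. Qed.

Lemma ripZl x (r : R) y : rip (r%:C *: y) x = r * rip y x.
Proof. by rewrite ripC ripZr [rip x _]ripC. Qed.

Lemma ripNl x y : rip (- y) x = - rip y x.
Proof. by rewrite ripC ripNr [rip x _]ripC. Qed.

Lemma ripBl x y z : rip (y - z) x = rip y x - rip z x.
Proof. by rewrite ripDl ripNl. Qed.

Lemma Im_ip x y : complex.Im (ip dot x y) = rip x (- 'i *: y).
Proof. by rewrite /rip ipZr Re_mulc /= oppr0 mul0r sub0r mulN1r opprK. Qed.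

Hypothesis norm_dot : inner_product_norm dot.

Lemma normr_rnorm x : `|x| = (rnorm x)%:C.
Proof. by rewrite /rnorm RRe_real// normr_real. Qed.

Lemma rnorm_ge0 x : 0 <= rnorm x.
Proof. by rewrite -ler0c -normr_rnorm. Qed.

Lemma rnorm_sqr x : rnorm x ^+ 2 = rip x x.
Proof. by rewrite /rip -norm_dot normr_rnorm -rmorphXn. Qed.

Lemma rip_ge0 x : 0 <= rip x x.
Proof. by rewrite -rnorm_sqr sqr_ge0. Qed.

Lemma rnorm_eq0 x : rnorm x = 0 -> x = 0.
Proof. by move=> x0; apply/normr0_eq0; rewrite normr_rnorm x0. Qed.

Lemma rip_CauchySchwarz x y : `|rip x y| <= rnorm x * rnorm y.
Proof.
have rnorm_gt0 z : z != 0 -> 0 < rnorm z.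
  move=> z0; rewrite lt_neqAle rnorm_ge0 andbT eq_sym.
  by apply/contra_neq/z0; apply: rnorm_eq0.
have [->|x0] := eqVneq x 0.
  by rewrite ripC /rip ip0r normr0 mulr_ge0 ?rnorm_ge0.
have [->|y0] := eqVneq y 0.
  by rewrite /rip ip0r normr0 mulr_ge0 ?rnorm_ge0.
(* expand |(|y| x +- |x| y)|^2 >= 0 and divide by |x||y| *)
have xy : 0 < rnorm x * rnorm y by rewrite mulr_gt0 ?rnorm_gt0.
rewrite ler_norml; apply/andP; split.
  have := rip_ge0 ((rnorm y)%:C *: x + (rnorm x)%:C *: y).
  rewrite ripDr !ripDl !ripZr !ripZl -!rnorm_sqr [rip y x]ripC => h.
  rewrite -(ler_pM2l xy); nra.
have := rip_ge0 ((rnorm y)%:C *: x - (rnorm x)%:C *: y).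
rewrite ripBr !ripBl !ripZr !ripZl -!rnorm_sqr [rip y x]ripC => h.
rewrite -(ler_pM2l xy); nra.
Qed.

Lemma cvg_rnormP (T : Type) (F : set_system T) {FF : Filter F} (f : T -> H) (l : H) :
  f @ F --> l <-> (fun t => rnorm (f t - l)) @ F --> (0 : R).
Proof.
split=> [/cvgrPdist_lt fl|/cvgrPdist_lt fl]; apply/cvgrPdist_lt.
  move=> e e0; have e0' : 0 < e%:C by rewrite ltcR.
  apply: filterS (fl _ e0') => t.
  by rewrite distrC normr_rnorm ltcR sub0r normrN ger0_norm ?rnorm_ge0.
move=> [e e'] /[dup] /andP[/eqP/= -> e0] _.
apply: filterS (fl _ e0) => t.
by rewrite sub0r normrN ger0_norm ?rnorm_ge0// distrC normr_rnorm ltcR.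
Qed.

Lemma cvg_rip (T : Type) (F : set_system T) {FF : Filter F} (f g : T -> H) (l m : H) :
  f @ F --> l -> g @ F --> m -> (fun t => rip (f t) (g t)) @ F --> rip l m.
Proof.
move=> /cvg_rnormP fl /cvg_rnormP gm.
have bound t : `|rip (f t) (g t) - rip l m| <=
    rnorm (f t - l) * rnorm (g t - m) + rnorm (f t - l) * rnorm m +
    rnorm l * rnorm (g t - m).
  have -> : rip (f t) (g t) - rip l m =
      rip (f t - l) (g t - m) + rip (f t - l) m + rip l (g t - m).
    by rewrite !ripBr !ripBl; ring.
  rewrite (le_trans (ler_normD _ _))// lerD ?rip_CauchySchwarz//.
  by rewrite (le_trans (ler_normD _ _))// lerD ?rip_CauchySchwarz.
have : (rnorm (f t - l) * rnorm (g t - m) + rnorm (f t - l) * rnorm m +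
    rnorm l * rnorm (g t - m))
  @[t --> F] --> 0 * 0 + 0 * rnorm m + rnorm l * 0.
  apply: cvgD; first by apply: cvgD; apply: cvgM => //; apply: cvg_cst.
  by apply: cvgM => //; apply: cvg_cst.
rewrite !mul0r mulr0 !addr0 => /cvgrPdist_le h; apply/cvgrPdist_le => e /h.
apply: filterS => t; rewrite sub0r normrN distrC; apply: le_trans.
exact: le_trans (bound t) (ler_norm _).
Qed.

Lemma ip_rip_ext x y x' y' :
  (forall a, rip x (a *: y) = rip x' (a *: y')) -> ip dot x y = ip dot x' y'.
Proof.
move=> h; apply/eqP; rewrite eq_complex !Im_ip h eqxx andbT; apply/eqP.
by have := h 1; rewrite !scale1r.
Qed.
End InnerProduct.

(** * Fourier coefficients in a Hilbert basis *)

Section HilbertBasis.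
Context {R : realType} {H : completeNormedModType R[i]}.
Variable dot : {dot H for @Num.conj R[i]}.
Hypothesis norm_dot : inner_product_norm dot.
Variable phi : nat -> H.
Hypothesis phi_basis : hilbert_basis dot phi.
Implicit Types (x y z : H) (a : R[i]) (c : nat -> R[i]).

Definition fcoef x j : R[i] := ip dot (phi j) x.

Definition comb c (n : nat) : H := series (fun j => c j *: phi j) n.

Lemma fcoef_comb c n i : fcoef (comb c n) i = if (i < n)%N then c i else 0.
Proof.
rewrite /fcoef /comb /series/= ip_sumr.
rewrite (eq_bigr (fun j => if j == i then c j else 0)); last first.
  move=> j _; rewrite ipZr phi_basis.1 eq_sym.
  by case: eqP => _; rewrite ?mulr1 ?mulr0.
by rewrite -big_mkcond/= big_nat1_eq.
Qed.

Lemma rip_comb c n y :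
  rip dot (comb c n) y = \sum_(0 <= j < n) complex.Re (conjc (c j) * fcoef y j).
Proof.
rewrite /comb /series/=; elim: n => [|n IH].
  by rewrite !big_geq// ripC /rip ip0r.
by rewrite !big_nat_recr//= ripDl IH; congr (_ + _); rewrite /rip ipZl.
Qed.

Lemma rnorm_comb c n : rnorm (comb c n) ^+ 2 = \sum_(0 <= j < n) normsq (c j).
Proof.
rewrite (rnorm_sqr norm_dot) rip_comb; apply: eq_big_nat => j /andP[_ jn].
by rewrite fcoef_comb jn Re_conjcM.
Qed.

Lemma rnorm_combB c m n : (m <= n)%N ->
  rnorm (comb c n - comb c m) ^+ 2 = \sum_(m <= j < n) normsq (c j).
Proof.
move=> mn; rewrite (rnorm_sqr norm_dot) ripBr !ripBl -!(rnorm_sqr norm_dot).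
rewrite [rip _ (comb c n) (comb c m)]ripC.
have -> : rip dot (comb c m) (comb c n) = rnorm (comb c m) ^+ 2.
  rewrite rip_comb rnorm_comb; apply: eq_big_nat => j /andP[_ jm].
  by rewrite fcoef_comb (leq_trans jm mn) Re_conjcM.
rewrite !rnorm_comb [X in X - _ - _](big_cat_nat (leq0n m) mn)/=; ring.
Qed.

(** Riesz-Fischer: partial sums of an orthogonal series are Cauchy in H exactly
    when those of the squared coefficients are Cauchy in R. *)
Lemma comb_cvg c (M : R) : (forall n, \sum_(0 <= j < n) normsq (c j) <= M) ->
  cvgn (comb c).
Proof.
move=> cM.
have : cvgn (series (fun j => normsq (c j))).
  apply: nondecreasing_is_cvgn.
    by apply: nondecreasing_series => j _ _; exact: normsq_ge0.
  by exists M => _ [n _ <-]; apply: cM.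
move=> /cauchy_cvgP/cauchy_seriesP h.
apply/cauchy_cvgP/cauchy_seriesP => -[e e'] /[dup] /andP[/eqP/= -> e0] _.
have e2 : 0 < e ^+ 2 by rewrite exprn_gt0.
apply: filterS (h _ e2) => -[m n] /=.
have [mn|nm] := leqP m n; last first.
  by move=> _; rewrite big_geq ?(ltnW nm)// normr0 ltcR.
rewrite ger0_norm; last by apply: sumr_ge0 => j _; exact: normsq_ge0.
rewrite -rnorm_combB// => mne.
have : rnorm (comb c n - comb c m) < e.
  by rewrite -(@ltr_pXn2r _ 2) ?nnegrE ?rnorm_ge0 ?ltW.
rewrite /comb sub_series mn => {}mne.
by rewrite normr_rnorm ltcR.
Qed.

Lemma fcoef_lim c x : comb c @ \oo --> x -> fcoef x = c.
Proof.
move=> cx; apply/funext => i.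
have key a : rip dot (phi i) (a *: x) = complex.Re (a * c i).
  have h1 : (fun n => rip dot (Num.conj a *: phi i) (comb c n)) @ \oo
      --> rip dot (Num.conj a *: phi i) x.
    by apply: cvg_rip => //; apply: cvg_cst.
  have e1 z : rip dot (Num.conj a *: phi i) z = rip dot (phi i) (a *: z).
    by rewrite /rip ipZl ipZr conjCK.
  rewrite -e1; apply: (cvg_unique _ h1) => //.
  apply: cvg_near_cst; exists i.+1 => // n /= ni.
  rewrite e1 /rip ipZr; congr (complex.Re (a * _)).
  by rewrite -/(fcoef _ i) fcoef_comb ni.
apply/eqP; rewrite eq_complex /fcoef Im_ip key.
have -> : complex.Re (ip dot (phi i) x) = complex.Re (c i).
  by have := key 1; rewrite scale1r mul1r.
rewrite eqxx/=; apply/eqP; case: (c i) => a b /=; ring.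
Qed.

Lemma fcoefB x y j : fcoef (x - y) j = fcoef x j - fcoef y j.
Proof. by rewrite /fcoef ipDr ipNr. Qed.

Lemma fcoefD x y j : fcoef (x + y) j = fcoef x j + fcoef y j.
Proof. exact: ipDr. Qed.

Lemma fcoefN x j : fcoef (- x) j = - fcoef x j.
Proof. exact: ipNr. Qed.

Lemma fcoefZ a x j : fcoef (a *: x) j = a * fcoef x j.
Proof. exact: ipZr. Qed.

(** A vector orthogonal to the basis is orthogonal to its dense span, hence to
    itself. *)
Lemma fcoef_total x : (forall j, fcoef x j = 0) -> x = 0.
Proof.
move=> x0; apply: rnorm_eq0.
apply/eqP; rewrite -sqrf_eq0 eq_le sqr_ge0 andbT (rnorm_sqr norm_dot).
have := @closure_le R _ _ (rip dot x) (fun=> 0) x _ _ _ (dense_closure phi_basis.2).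
apply.
- by apply: cvg_rip => //; apply: cvg_cst.
- exact: cvg_cst.
move=> _ [n [c ->]].
have -> : \sum_(j < n) c j *: phi j = comb c n by rewrite /comb /series/= big_mkord.
rewrite ripC rip_comb big1// => j _.
by rewrite x0 mulr0.
Qed.

Lemma bessel x n : \sum_(0 <= j < n) normsq (fcoef x j) <= rnorm x ^+ 2.
Proof.
have := rip_ge0 norm_dot (x - comb (fcoef x) n).
rewrite ripBr !ripBl [rip dot x (comb _ _)]ripC -!(rnorm_sqr norm_dot).
suff -> : rip dot (comb (fcoef x) n) x = rnorm (comb (fcoef x) n) ^+ 2.
  by rewrite rnorm_comb; lra.
rewrite rnorm_comb rip_comb; apply: eq_bigr => j _.
by rewrite Re_conjcM.
Qed.

(** By Riesz-Fischer the Fourier series of x converges; its sum has the same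
    coefficients as x, so it is x. *)
Lemma fourier_expansion x : comb (fcoef x) @ \oo --> x.
Proof.
have cvx := comb_cvg (bessel x).
suff xE : x = limn (comb (fcoef x)) by rewrite [X in _ --> X]xE.
apply/eqP; rewrite -subr_eq0; apply/eqP/fcoef_total => j.
by rewrite fcoefB (fcoef_lim cvx) subrr.
Qed.

Lemma parseval x y :
  (fun n => \sum_(0 <= j < n) complex.Re (conjc (fcoef x j) * fcoef y j)) @ \oo
    --> rip dot x y.
Proof.
under [X in X @ _]funext do rewrite -rip_comb.
apply: cvg_rip => //; last exact: cvg_cst.
exact: fourier_expansion.
Qed.

Lemma ip_coef_ext x y x' y' :
  (forall j, conjc (fcoef x j) * fcoef y j = conjc (fcoef x' j) * fcoef y' j) ->
  ip dot x y = ip dot x' y'.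
Proof.
move=> h; apply: ip_rip_ext => a.
apply: (cvg_unique _ (@parseval x (a *: y))) => //.
have := @parseval x' (a *: y').
suff -> : (fun n => \sum_(0 <= j < n)
       complex.Re (conjc (fcoef x' j) * fcoef (a *: y') j)) =
   (fun n => \sum_(0 <= j < n)
       complex.Re (conjc (fcoef x j) * fcoef (a *: y) j)) by [].
apply/funext => n; apply: eq_bigr => j _; congr complex.Re.
by rewrite /fcoef !ipZr [LHS]mulrCA [RHS]mulrCA -/(fcoef x j) -/(fcoef y j) h.
Qed.

(** Parseval turns an inequality between inner products into one between
    coefficients; this is how every functional-calculus estimate is checked. *)
Lemma rip_coef_le x y x' y' :
  (forall j, complex.Re (conjc (fcoef x j) * fcoef y j) <=
             complex.Re (conjc (fcoef x' j) * fcoef y' j)) ->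
  rip dot x y <= rip dot x' y'.
Proof.
move=> h; apply: ler_cvg_to (@parseval x y) (@parseval x' y') _.
by apply: nearW => n; apply: ler_sum => j _.
Qed.

Lemma rip_coef_ge0 x y :
  (forall j, 0 <= complex.Re (conjc (fcoef x j) * fcoef y j)) -> 0 <= rip dot x y.
Proof.
move=> xy; have <- : rip dot 0 0 = 0 by rewrite /rip ip0r.
by apply: rip_coef_le => j; rewrite [fcoef 0 j]ip0r mulr0.
Qed.

Lemma rip_coef_eq0 x y :
  (forall j, complex.Re (conjc (fcoef x j) * fcoef y j) = 0) -> rip dot x y = 0.
Proof.
move=> xy; have rip00 : rip dot 0 0 = 0 by rewrite /rip ip0r.
by apply/le_anti/andP; split; rewrite -{1}rip00; apply: rip_coef_le => j;
  rewrite xy [fcoef 0 j]ip0r mulr0.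
Qed.

Lemma bessel_le x (M : R) :
  (forall n, \sum_(0 <= j < n) normsq (fcoef x j) <= M) -> rnorm x ^+ 2 <= M.
Proof.
move=> xM; rewrite (rnorm_sqr norm_dot).
apply: ler_cvg_to (@parseval x x) (cvg_cst M) _.
apply: nearW => n; apply: le_trans (xM n); rewrite le_eqVlt; apply/orP; left.
apply/eqP/eq_bigr => j _.
by rewrite Re_conjcM.
Qed.
End HilbertBasis.

(** * Diagonal operators *)

Section Diagonal.
Context {R : realType} {H : completeNormedModType R[i]}.
Variable dot : {dot H for @Num.conj R[i]}.
Hypothesis norm_dot : inner_product_norm dot.
Variable phi : nat -> H.
Hypothesis phi_basis : hilbert_basis dot phi.
Implicit Types (x y z : H) (r : nat -> R).
Local Notation cf := (fcoef dot phi).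

(** Functions of A in its eigenbasis: powers of the eigenvalues give [abspow],
    while bounded r give the everywhere defined operators that regularize it. *)
Definition diag r x := limn (comb phi (fun j => (r j)%:C * cf x j)).

Lemma abspowE (lambda : nat -> R) s :
  abspow dot lambda phi s = diag (fun j => lambda j `^ s).
Proof. by []. Qed.

Lemma fcoef_inj x y : cf x =1 cf y -> x = y.
Proof.
move=> xy; apply/eqP; rewrite -subr_eq0; apply/eqP/(fcoef_total norm_dot phi_basis) => j.
by apply/eqP; rewrite fcoefB subr_eq0; apply/eqP/xy.
Qed.

Lemma fcoef_diag_dom r x (M : R) :
  (forall n, \sum_(0 <= j < n) r j ^+ 2 * normsq (cf x j) <= M) ->
  forall j, cf (diag r x) j = (r j)%:C * cf x j.
Proof.
move=> rM j.
suff /(fcoef_lim norm_dot phi_basis) -> :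
  comb phi (fun j => (r j)%:C * cf x j) @ \oo --> diag r x by [].
apply: (comb_cvg norm_dot phi_basis) (M) _ => n.
by under eq_bigr do rewrite normsqZ.
Qed.

Variables (r : nat -> R) (M : R).
Hypothesis rM : forall j, `|r j| <= M.

Lemma diag_bound x n :
  \sum_(0 <= j < n) r j ^+ 2 * normsq (cf x j) <= M ^+ 2 * rnorm x ^+ 2.
Proof.
apply: le_trans (ler_wpM2l (sqr_ge0 M) (bessel norm_dot phi_basis x n)).
rewrite mulr_sumr; apply: ler_sum => j _.
rewrite ler_wpM2r ?addr_ge0 ?sqr_ge0//.
by rewrite -real_normK ?num_real// lerXn2r ?nnegrE// (le_trans _ (rM j)).
Qed.

Lemma fcoef_diag x j : cf (diag r x) j = (r j)%:C * cf x j.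
Proof. exact: fcoef_diag_dom (diag_bound x) j. Qed.

Lemma rnorm_diag x : rnorm (diag r x) <= M * rnorm x.
Proof.
have M0 : 0 <= M by rewrite (le_trans _ (rM 0%N)).
rewrite -(@ler_pXn2r _ 2) ?nnegrE ?mulr_ge0 ?rnorm_ge0// exprMn.
apply: (bessel_le norm_dot phi_basis) => n.
under eq_bigr do rewrite fcoef_diag normsqZ.
exact: diag_bound.
Qed.

Lemma diagB x y : diag r (x - y) = diag r x - diag r y.
Proof.
apply: fcoef_inj => j; by rewrite fcoefB !fcoef_diag fcoefB mulrBr.
Qed.

Lemma diag_sym x y : ip dot (diag r x) y = ip dot x (diag r y).
Proof.
apply: (ip_coef_ext norm_dot phi_basis) => j; rewrite !fcoef_diag rmorphM/=.
by rewrite [X in X * _ * _]conjc_real [RHS]mulrCA mulrA.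
Qed.

Lemma diag_continuous : continuous (diag r).
Proof.
have M0 : 0 <= M by rewrite (le_trans _ (rM 0%N)).
move=> x; apply/(@cvg_rnormP R H).
have xx : (fun y => rnorm (y - x)) @ x --> (0 : R) by apply/(@cvg_rnormP R H).
apply: (@squeeze_cvgr _ _ _ _ (fun=> 0) (fun y => M * rnorm (y - x))).
- by apply: nearW => y; rewrite rnorm_ge0 -diagB rnorm_diag.
- exact: cvg_cst.
- by rewrite -(mulr0 M); apply: cvgM => //; exact: cvg_cst.
Qed.
End Diagonal.

(** * Energy growth along a unitary group *)

Section Group.
Context {R : realType} {H : completeNormedModType R[i]}.
Variable dot : {dot H for @Num.conj R[i]}.
Hypothesis norm_dot : inner_product_norm dot.

(** [expR (- a t) * g t] is non-increasing. *)
Lemma gronwall (g dg : R -> R) (a : R) :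
  (forall t : R, is_derive t (1 : R) g (dg t)) -> (forall t, dg t <= a * g t) ->
  forall t, 0 <= t -> g t <= expR (a * t) * g 0.
Proof.
move=> gd dga t t0.
pose f s := expR (- a * s) * g s.
have fd s : is_derive s (1 : R) f (expR (- a * s) * dg s + g s * (expR (- a * s) * - a)).
  by apply: is_deriveM; apply: is_derive_eq; rewrite /GRing.scale/= mulr1.
have fle : f t <= f 0.
  apply: (@ler0_derive1_le_cc _ f 0 t) => //; rewrite ?in_itv/= ?lexx ?t0//.
  - move=> s _; have fds := fd s; rewrite derive1E derive_val.
    have := dga s; have := expR_gt0 (- a * s).
    by move=> e0 h; rewrite [X in _ + X]mulrCA -mulrDr pmulr_rle0// mulrN subr_le0 mulrC.
  - by apply: derivable_within_continuous => s _; exact: ex_derive.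
move: fle; rewrite /f mulr0 expR0 mul1r mulNr => h.
by rewrite -ler_pdivrMl ?expR_gt0// -expRN.
Qed.

(** Along an orbit that starts in the domain of the generator S, the derivative
    of <N x, x> is 2 Re <N x, S x>, since N is symmetric; Gronwall then bounds
    its growth. Both sides are continuous in the initial vector, so the bound
    extends from the dense domain of S to all of H. *)
Lemma group_energy (U : R -> H -> H) (N : H -> H) (a : R) :
  unitary_group U ->
  continuous N ->
  (forall x y, rip dot (N x) y = rip dot x (N y)) ->
  (forall z, generator U z -> rip dot (N z.1) z.2 <= a * rip dot (N z.1) z.1) ->
  dense (gdom (generator U)) ->
  forall x (t : R), 0 <= t ->
    rip dot (N (U t x)) (U t x) <= expR (2 * a * t) * rip dot (N x) x.
Proof.
move=> [Ulin Uiso U0 UD Ucont] Ncont Nsym Na Gdense x t t0.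
have UB s y z : U s (y - z) = U s y - U s z.
  by rewrite -[in LHS]scaleN1r addrC Ulin scaleN1r addrC.
have UZ s b y : U s (b *: y) = b *: U s y.
  by have := Ulin s b y 0; rewrite addr0 -[0 in X in _ + X](subrr y) UB subrr addr0.
have Ucts s : continuous (U s).
  move=> y; apply/(@cvg_rnormP R H) => /=.
  have : (fun z => rnorm (z - y)) @ y --> (0 : R) by apply/(@cvg_rnormP R H).
  by under eq_fun do rewrite /rnorm -(Uiso s) UB.
have main z : generator U z ->
    rip dot (N (U t z.1)) (U t z.1) <= expR (2 * a * t) * rip dot (N z.1) z.1.
  move=> Gz.
  (* the group commutes with its generator *)
  have GU s : generator U (U s z.1, U s z.2).
    rewrite /generator/=.
    have := @cvg_comp _ _ _ _ (U s) _ _ _ Gz (Ucts s z.2).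
    apply: cvg_trans; apply: near_eq_cvg; apply: nearW => h /=.
    by rewrite UZ UB -!UD [h + s]addrC.
  have gd s : is_derive s (1 : R) (fun s => rip dot (N (U s z.1)) (U s z.1))
      (2 * rip dot (N (U s z.1)) (U s z.2)).
    set y := U s z.1; set w := U s z.2.
    have Uy : U h y @[h --> (0:R)^'] --> y.
      by apply: cvg_trans (Ucont y); apply: cvg_app; exact: cvg_within.
    have quot : (fun h : R => h^-1 *: (rip dot (N (U (h *: 1 + s) z.1))
        (U (h *: 1 + s) z.1) - rip dot (N y) y)) @ (0:R)^' --> 2 * rip dot (N y) w.
      have -> : 2 * rip dot (N y) w = rip dot w (N y) + rip dot w (N y).
        by rewrite [rip dot w _]ripC; ring.
      have c1 : (fun h => rip dot ((h^-1)%:C *: (U h y - y)) (N (U h y))) @ (0:R)^'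
          --> rip dot w (N y).
        by apply: (cvg_rip norm_dot (GU s)); exact: (cvg_comp _ _ Uy (Ncont y)).
      have c2 : (fun h => rip dot ((h^-1)%:C *: (U h y - y)) (N y)) @ (0:R)^'
          --> rip dot w (N y).
        by apply: (cvg_rip norm_dot (GU s)); exact: cvg_cst.
      suff -> : (fun h : R => h^-1 *: (rip dot (N (U (h *: 1 + s) z.1))
            (U (h *: 1 + s) z.1) - rip dot (N y) y)) =
          (fun h => rip dot ((h^-1)%:C *: (U h y - y)) (N (U h y)) +
            rip dot ((h^-1)%:C *: (U h y - y)) (N y)) by exact: cvgD c1 c2.
      apply/funext => h; rewrite !ripZl -mulrDr /GRing.scale/= mulr1 UD -/y.
      congr (_ * _); rewrite !ripBl Nsym [rip dot (N y) y]Nsym.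
      rewrite [rip dot y (N (U h y))]ripC Nsym; ring.
    apply: DeriveDef; first by apply/cvg_ex; exists (2 * rip dot (N y) w); exact: quot.
    exact: cvg_lim quot.
  have := gronwall gd _ t0; rewrite U0; apply=> s.
  by rewrite -mulrA ler_pM2l// (Na _ (GU s)).
apply: (@closure_le R H (gdom (generator U)) (fun y => rip dot (N (U t y)) (U t y))
  (fun y => expR (2 * a * t) * rip dot (N y) y) x _ _ _ (dense_closure Gdense)).
- exact: (cvg_rip norm_dot (cvg_comp _ _ (Ucts t x) (Ncont (U t x))) (Ucts t x)).
- apply: cvgM; first exact: cvg_cst.
  exact: (cvg_rip norm_dot (Ncont x) cvg_id).
by move=> _ [z Gz <-]; exact: main.
Qed.
End Group.

(** * Skew-adjoint operators *)

Section Skew.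
Context {R : realType} {H : completeNormedModType R[i]}.
Variable dot : {dot H for @Num.conj R[i]}.
Hypothesis norm_dot : inner_product_norm dot.

Lemma skew_adjointE (G : set (H * H)) z w : skew_adjoint dot G -> G z -> G w ->
  ip dot w.2 z.1 = - ip dot w.1 z.2.
Proof.
move=> [_ Gadj] Gz Gw; rewrite -ipNr.
have : adjoint dot G (z.1, - z.2) by rewrite Gadj/= opprK -surjective_pairing.
by move/(_ _ Gw).
Qed.

Lemma skew_adjoint_rip0 (G : set (H * H)) z : skew_adjoint dot G -> G z ->
  rip dot z.1 z.2 = 0.
Proof.
move=> skG Gz; have := skew_adjointE skG Gz Gz.
move=> /(congr1 (@complex.Re R)); rewrite -[LHS]/(rip dot _ _) ripC raddfN/=.
by rewrite -/(rip dot z.1 z.2); lra.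
Qed.

Variables (A : linop H) (lambda : nat -> R) (phi : nat -> H).
Hypothesis cond_ii : condition_ii dot A lambda phi.

Let phi_basis : hilbert_basis dot phi. Proof. by case: cond_ii. Qed.
Let skA : skew_adjoint dot (linop_graph A). Proof. by case: cond_ii. Qed.

(** Skew-adjointness moves A onto its eigenvector [phi j]. *)
Lemma fcoef_A x j : dom A x ->
  fcoef dot phi (A x) j = - ('i * (lambda j)%:C) * fcoef dot phi x j.
Proof.
move=> Ax; have [_ _ _ _ /(_ j)[dphi Aphi]] := cond_ii.
have /= := @skew_adjointE _ (x, A x) (phi j, A (phi j)) skA.
move=> /(_ (conj Ax erefl) (conj dphi erefl)).
rewrite Aphi ipZl -/(fcoef dot phi x j) -/(fcoef dot phi (A x) j).
move/(congr1 -%R); rewrite opprK => <-.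
rewrite -mulNr; congr (_ * _).
by apply/eqP; rewrite eq_complex/=; apply/andP; split; apply/eqP; ring.
Qed.

Variables (r : nat -> R) (M : R).
Hypothesis rM : forall j, `|r j| <= M.

(** A bounded diagonal operator D commutes with A: by Parseval, the pair
    (D x, - D A x) satisfies the identity that defines the adjoint of A, and this
    adjoint is - A. *)
Lemma diag_dom x : dom A x -> dom A (diag dot phi r x).
Proof.
move=> Ax.
have [_ Aadj] := skA.
have : adjoint dot (linop_graph A) (diag dot phi r x, - diag dot phi r (A x)).
  move=> [w w'] [/= Aw ->].
  apply: (ip_coef_ext norm_dot phi_basis) => j.
  rewrite fcoefN !(fcoef_diag norm_dot phi_basis rM).
  rewrite !fcoef_A//.
  case: (fcoef _ _ w j) (fcoef _ _ x j) => [a b] [c d].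
  by apply/eqP; rewrite eq_complex/=; apply/andP; split; apply/eqP; ring.
by rewrite Aadj => -[].
Qed.
End Skew.

(** * The domains and norms of the powers of |A| *)

Section Scale.
Context {R : realType} {H : completeNormedModType R[i]}.
Variable dot : {dot H for @Num.conj R[i]}.
Hypothesis norm_dot : inner_product_norm dot.
Variables (lambda : nat -> R) (phi : nat -> H).
Hypothesis phi_basis : hilbert_basis dot phi.

Lemma abspow_summand s x j :
  lambda j `^ (2 * s) * complex.Re `|ip dot (phi j) x| ^+ 2 =
  (lambda j `^ s) ^+ 2 * normsq (fcoef dot phi x j).
Proof. by rewrite normsq_norm [2 * s]mulrC powRrM powR_mulrn// powR_ge0. Qed.

Lemma dom_abspowP s x : dom_abspow dot lambda phi s x <->
  exists M, forall n,
    \sum_(0 <= j < n) (lambda j `^ s) ^+ 2 * normsq (fcoef dot phi x j) <= M.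
Proof.
rewrite /dom_abspow/=; under eq_eseriesr do rewrite abspow_summand.
have ge0 n : (0 <= n)%N -> predT n ->
   (0 <= ((lambda n `^ s) ^+ 2 * normsq (fcoef dot phi x n))%:E)%E.
  by move=> _ _; rewrite lee_fin mulr_ge0 ?addr_ge0 ?sqr_ge0.
split=> [fin|[M sM]].
  have fin' : (\sum_(0 <= j <oo) ((lambda j `^ s) ^+ 2 * normsq (fcoef dot phi x j))%:E)%E
     \is a fin_num.
    by rewrite ge0_fin_numE//; apply: nneseries_ge0.
  exists (fine (\sum_(0 <= j <oo)
    ((lambda j `^ s) ^+ 2 * normsq (fcoef dot phi x j))%:E)%E).
  move=> n; rewrite -lee_fin fineK// -sumEFin.
  exact: nneseries_lim_ge n ge0.
apply: le_lt_trans (ltry M); apply: lime_le.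
  exact: is_cvg_nneseries ge0.
by apply: nearW => n; rewrite sumEFin lee_fin.
Qed.

Lemma norm_s_le s x (M : R) :
  (forall n, \sum_(0 <= j < n) (lambda j `^ s) ^+ 2 * normsq (fcoef dot phi x j) <= M) ->
  norm_s dot lambda phi s x ^+ 2 <= M.
Proof.
move=> sM; rewrite /norm_s abspowE; apply: (bessel_le norm_dot phi_basis) => n.
by under eq_bigr do rewrite (fcoef_diag_dom norm_dot phi_basis sM) normsqZ.
Qed.
End Scale.

(** * The regularized energy estimate *)

Section Energy.
Context {R : realType} {H : completeNormedModType R[i]}.
Variable dot : {dot H for @Num.conj R[i]}.
Hypothesis norm_dot : inner_product_norm dot.
Variables (p : nat) (A : linop H) (B : 'I_p -> linop H).
Variables (lambda : nat -> R) (phi : nat -> H) (k : R).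
Hypothesis cond_i : condition_i dot A B.
Hypothesis cond_ii : condition_ii dot A lambda phi.
Hypothesis coupled : weakly_coupled dot A B lambda phi k.

Let phi_basis : hilbert_basis dot phi. Proof. by case: cond_ii. Qed.
Local Notation cf := (fcoef dot phi).
Local Notation c_k := (coupling_constant dot B lambda phi k).
Local Notation ev j := (lambda j `^ k).

Lemma coupling_constant_ge0 : 0 <= c_k.
Proof.
rewrite /coupling_constant; set E := [set _ | _].
have [hE|hE] := pselect (has_sup E); last by rewrite sup_out.
have [[e Ee] ubE] := hE; apply: le_trans (ub_le_sup ubE Ee).
by case: Ee => psi [l [_ _ ->]]; rewrite divr_ge0 ?Re_norm_ge0.
Qed.

(** The weak coupling makes the set of quotients bounded, so that its supremum
    dominates each of them. *)
Lemma coupling_bound l x : coupling_dom dot B lambda phi k l x ->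
  `|rip dot (abspow dot lambda phi k x) (B l x)| <=
  c_k * complex.Re `|ip dot (abspow dot lambda phi k x) x|.
Proof.
move=> lx; have [_ [C hC]] := coupled.
have [De|Dn] := eqVneq (complex.Re `|ip dot (abspow dot lambda phi k x) x|) 0.
  by have := hC _ _ lx; rewrite De !mulr0.
have Dp : 0 < complex.Re `|ip dot (abspow dot lambda phi k x) x|.
  by rewrite lt_neqAle eq_sym Dn Re_norm_ge0.
rewrite -ler_pdivrMr//; apply: ub_le_sup.
  exists `|C| => _ [y [l' [ly _ ->]]].
  have [->|Dy0] := eqVneq (complex.Re `|ip dot (abspow dot lambda phi k y) y|) 0.
    by rewrite invr0 mulr0.
  have Dy : 0 < complex.Re `|ip dot (abspow dot lambda phi k y) y|.
    by rewrite lt_neqAle eq_sym Dy0 Re_norm_ge0.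
  by rewrite ler_pdivrMr// (le_trans (hC _ _ ly))// ler_wpM2r ?ler_norm// ltW.
exists x, l; split=> //.
by apply: contra_neq Dn => ->; rewrite ip0r normr0.
Qed.

(** With N = |A|^k, these are the symbols of the bounded operators
    (1 + e N)^-1 and N (1 + e N)^-1; the second increases to N as e
    decreases to 0. *)
Definition resolvent (e : R) j := (1 + e * ev j)^-1.
Definition yosida (e : R) j := ev j * resolvent e j.

Lemma ev_ge0 j : 0 <= ev j. Proof. exact: powR_ge0. Qed.

Section Regularization.
Variable e : R.
Hypothesis e_gt0 : 0 < e.

Let den_gt0 j : 0 < 1 + e * ev j.
Proof. by rewrite ltr_wpDr// mulr_ge0 ?ev_ge0// ltW. Qed.

Lemma resolvent_ge0 j : 0 <= resolvent e j. Proof. by rewrite invr_ge0 ltW. Qed.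

Lemma yosida_ge0 j : 0 <= yosida e j.
Proof. by rewrite mulr_ge0 ?ev_ge0 ?resolvent_ge0. Qed.

Lemma resolvent_yosida j : resolvent e j + e * yosida e j = 1.
Proof. by rewrite /yosida /resolvent; field; rewrite gt_eqF. Qed.

Lemma resolvent_bound j : `|resolvent e j| <= 1.
Proof.
rewrite ger0_norm ?resolvent_ge0// -(resolvent_yosida j) lerDl.
by rewrite mulr_ge0 ?yosida_ge0// ltW.
Qed.

Lemma yosida_bound j : `|yosida e j| <= e^-1.
Proof.
rewrite ger0_norm ?yosida_ge0// -[e^-1]mul1r ler_pdivlMr// -(resolvent_yosida j).
by rewrite mulrC lerDr resolvent_ge0.
Qed.

Lemma yosida_le j : yosida e j <= ev j.
Proof.
rewrite /yosida ler_piMr ?ev_ge0//.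
by rewrite (le_trans (ler_norm _))// resolvent_bound.
Qed.

Lemma yosida_lower j : ev j - e * ev j ^+ 2 <= yosida e j.
Proof.
have resE : resolvent e j = 1 - e * yosida e j.
  by rewrite -(resolvent_yosida j) addrK.
have -> : yosida e j = ev j - e * (ev j * yosida e j).
  by rewrite {1}/yosida resE; ring.
rewrite lerD2l lerN2 ler_pM2l// expr2 ler_wpM2l ?ev_ge0//.
exact: yosida_le.
Qed.

Lemma abspow_resolvent x :
  abspow dot lambda phi k (diag dot phi (resolvent e) x) = diag dot phi (yosida e) x.
Proof.
rewrite abspowE /diag; congr (limn (comb phi _)); apply/funext => j.
by rewrite (fcoef_diag norm_dot phi_basis resolvent_bound) mulrA -rmorphM.
Qed.

Lemma dom_resolvent x : dom_abspow dot lambda phi k (diag dot phi (resolvent e) x).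
Proof.
apply/(dom_abspowP dot); exists (e^-1 ^+ 2 * rnorm x ^+ 2) => n.
under eq_bigr do
  rewrite (fcoef_diag norm_dot phi_basis resolvent_bound) normsqZ mulrA -exprMn.
exact: (diag_bound norm_dot phi_basis yosida_bound).
Qed.

Lemma diag_split x :
  x = e%:C *: diag dot phi (yosida e) x + diag dot phi (resolvent e) x.
Proof.
apply: (fcoef_inj norm_dot phi_basis) => j.
rewrite fcoefD fcoefZ (fcoef_diag norm_dot phi_basis resolvent_bound).
rewrite (fcoef_diag norm_dot phi_basis yosida_bound).
by rewrite mulrA -mulrDl -rmorphM -rmorphD addrC resolvent_yosida rmorph1 mul1r.
Qed.

Definition ctrl (v : 'rV[R]_p) x := A x + \sum_(l < p) (v ord0 l)%:C *: B l x.

Lemma ctrl_lin v a x y : dom A x -> dom A y ->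
  ctrl v (a *: x + y) = a *: ctrl v x + ctrl v y.
Proof.
move=> Ax Ay; have [AB _] := cond_i.
rewrite /ctrl app_P// scalerDr addrACA; congr (_ + _).
rewrite scaler_sumr -big_split/=; apply: eq_bigr => l _.
rewrite app_P; [|exact: AB|exact: AB].
by rewrite scalerDr !scalerA mulrC.
Qed.

(** Put chi = (1 + e N)^-1 x and nu = N chi, so that x = chi + e nu. In
    Re <nu, S x> the part e Re <nu, S nu> vanishes because S = A + sum v_l B_l is
    skew-symmetric, and Re <nu, A chi> vanishes because A and N are diagonal in
    the same basis. What is left, the sum of the v_l Re <N chi, B_l chi>, is
    bounded by the coupling constant: chi lies in the domain of N although x
    need not. *)
Lemma energy_dom v x : dom A x ->
  rip dot (diag dot phi (yosida e) x) (ctrl v x) <=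
  c_k * (\sum_(l < p) `|v ord0 l|) * rip dot (diag dot phi (yosida e) x) x.
Proof.
move=> Ax; set nu := diag dot phi (yosida e) x.
pose chi := diag dot phi (resolvent e) x.
have Achi := diag_dom norm_dot cond_ii resolvent_bound Ax.
have Anu := diag_dom norm_dot cond_ii yosida_bound Ax.
have cfchi j : cf chi j = (resolvent e j)%:C * cf x j.
  exact: (fcoef_diag norm_dot phi_basis resolvent_bound).
have cfnu j : cf nu j = (yosida e j)%:C * cf x j.
  exact: (fcoef_diag norm_dot phi_basis yosida_bound).
have xE : x = e%:C *: nu + chi by exact: diag_split.
have nuS : rip dot nu (ctrl v nu) = 0.
  have [_ /(_ v)[sk _]] := cond_i.
  have := @skew_adjoint_rip0 _ _ dot _ (nu, ctrl v nu) sk; apply.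
  by apply: subset_closure.
have nuA : rip dot nu (A chi) = 0.
  apply: (rip_coef_eq0 norm_dot phi_basis) => j.
  rewrite (fcoef_A cond_ii)// cfnu cfchi.
  by case: (cf x j) => a b /=; ring.
(* the coupling bound is stated with the modulus of <N chi, chi> *)
have nuchi_real : ip dot nu chi = (rip dot nu chi)%:C.
  apply/eqP; rewrite eq_complex eqxx/=.
  have : ip dot nu chi = ip dot chi nu.
    apply: (ip_coef_ext norm_dot phi_basis) => j; rewrite cfnu cfchi.
    case: (cf x j) => a b.
    by apply/eqP; rewrite eq_complex/=; apply/andP; split; apply/eqP; ring.
  rewrite [ip dot chi nu]ipC conj_conjc; case: (ip dot nu chi) => a b /= [].
  by move=> h; apply/eqP; lra.
have nuchi_ge0 : 0 <= rip dot nu chi.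
  apply: (rip_coef_ge0 norm_dot phi_basis) => j; rewrite cfnu cfchi.
  have -> : complex.Re (conjc ((yosida e j)%:C * cf x j) *
      ((resolvent e j)%:C * cf x j)) = yosida e j * resolvent e j * normsq (cf x j).
    by rewrite /normsq; case: (cf x j) => a b /=; ring.
  by apply: mulr_ge0; rewrite ?normsq_ge0// mulr_ge0 ?yosida_ge0 ?resolvent_ge0.
(* <nu, x> - <nu, chi> = e |nu|^2 *)
have nuchi_le : rip dot nu chi <= rip dot nu x.
  by rewrite [X in _ <= rip _ _ X]xE ripDr ripZr lerDr mulr_ge0 ?rip_ge0// ltW.
have cK : 0 <= c_k * \sum_(l < p) `|v ord0 l|.
  by rewrite mulr_ge0 ?coupling_constant_ge0 ?sumr_ge0.
apply: le_trans (ler_wpM2l cK nuchi_le).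
rewrite [X in ctrl v X]xE ctrl_lin// ripDr ripZr nuS mulr0 add0r.
rewrite /ctrl ripDr nuA add0r.
have rip_sum n (F : 'I_n -> H) :
    rip dot nu (\sum_(l < n) F l) = \sum_(l < n) rip dot nu (F l).
  by apply: (big_morph (rip dot nu)) => [y z|]; rewrite ?ripDr// /rip ip0r.
rewrite rip_sum mulrAC mulr_sumr; apply: ler_sum => l _.
rewrite ripZr [leRHS]mulrC; apply: le_trans (ler_norm _) _.
rewrite normrM ler_wpM2l// -[rip dot nu chi]ger0_norm//.
have := @coupling_bound l chi.
rewrite /chi abspow_resolvent -/nu -/chi nuchi_real.
have -> : complex.Re `|(rip dot nu chi)%:C| = `|rip dot nu chi|.
  by rewrite normc_def/= expr0n addr0 sqrtr_sqr.
by apply; split; [exact: dom_resolvent|have [AB _] := cond_i; exact: AB].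
Qed.

(** The generator is the closure of A + sum v_l B_l on the domain of A; since the
    regularized N is bounded, [energy_dom] passes to this closure. *)
Lemma energy_step v U x t : unitary_group U -> generator U = controlled A B v ->
  0 <= t ->
  rip dot (diag dot phi (yosida e) (U t x)) (U t x) <=
  expR (2 * (c_k * \sum_(l < p) `|v ord0 l|) * t) *
  rip dot (diag dot phi (yosida e) x) x.
Proof.
move=> gU UE t0.
have Ncont := diag_continuous norm_dot phi_basis yosida_bound.
apply: (group_energy norm_dot gU Ncont) => //.
- by move=> y z; rewrite /rip (diag_sym norm_dot phi_basis yosida_bound).
- rewrite UE => z Gz.
  have f1 : (fun q : H * H => diag dot phi (yosida e) q.1) @ z
      --> diag dot phi (yosida e) z.1.
    exact: (cvg_comp _ _ (@cvg_fst _ _ (nbhs z.1) (nbhs z.2) _) (Ncont z.1)).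
  apply: (@closure_le R _ (control_graph A B v)
    (fun q : H * H => rip dot (diag dot phi (yosida e) q.1) q.2)
    (fun q : H * H => c_k * (\sum_(l < p) `|v ord0 l|) *
       rip dot (diag dot phi (yosida e) q.1) q.1) z _ _ _ Gz).
  + by apply: cvg_rip => //; exact: cvg_snd.
  + apply: cvgM; first exact: cvg_cst.
    by apply: cvg_rip => //; exact: cvg_fst.
  + by move=> [q1 q2] [/= Aq ->]; exact: energy_dom.
- by rewrite UE; have [_ /(_ v)[[]]] := cond_i.
Qed.
End Regularization.
End Energy.

(** * The L1 norm of a piecewise constant control *)

Section Control.
Context {R : realType} {p : nat} (u : pcontrol R p).

Lemma knot_mono m n : (m <= n)%N -> (n <= (last_step u).+1)%N -> knot u m <= knot u n.
Proof.
move=> mn; rewrite -(subnKC mn); elim: (n - m)%N => [|d IH]; first by rewrite addn0.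
by rewrite addnS ltnS => h; rewrite (le_trans (IH (leqW h)))// knot_le.
Qed.

Lemma steps_disjoint m n (s : R) : (n <= last_step u)%N -> (m < n)%N ->
  s \in `[knot u m, knot u m.+1[ -> s \in `[knot u n, knot u n.+1[ -> False.
Proof.
move=> nN mn; rewrite !in_itv/= => /andP[_ sm] /andP[ns _].
have := lt_le_trans sm (le_trans (knot_mono mn (leqW nN)) ns).
by rewrite ltxx.
Qed.

(** At each time at most one step is active, so the modulus of the sum is the sum
    of the moduli. *)
Lemma pcontrol_fun_norm (s : R) l :
  `|pcontrol_fun u s ord0 l| =
  \sum_(n < (last_step u).+1) \1_(`[knot u n, knot u n.+1[%classic : set R) s *
     `|level u n ord0 l|.
Proof.
rewrite /pcontrol_fun summxE.
under eq_bigr do rewrite mxE.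
have [[n sn]|h] :=
  pselect (exists n : 'I_(last_step u).+1, s \in `[knot u n, knot u n.+1[).
  have out j : j != n -> \1_(`[knot u j, knot u j.+1[%classic : set R) s = 0 :> R.
    move=> jn; rewrite indicE; case: (boolP (_ \in _)) => //; rewrite inE/= => sj.
    have : (j < n)%N || (n < j)%N by rewrite -neq_ltn.
    have [nN jN] := (ltn_ord n, ltn_ord j).
    case/orP => h; exfalso.
      exact: (@steps_disjoint j n s).
    exact: (@steps_disjoint n j s).
  rewrite (bigD1 n)//= big1 ?addr0 => [|j jn]; last by rewrite out ?mul0r.
  rewrite (bigD1 n)//= big1 ?addr0 => [|j jn]; last by rewrite out ?mul0r.
  by rewrite normrM ger0_norm.
have out j : (j < (last_step u).+1)%N ->
    \1_(`[knot u j, knot u j.+1[%classic : set R) s = 0 :> R.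
  move=> jN; rewrite indicE; case: (boolP (_ \in _)) => //; rewrite inE/= => sj.
  by exfalso; apply: h; exists (Ordinal jN).
by rewrite !big1 ?normr0// => j _; rewrite out ?mul0r.
Qed.

Lemma pcontrol_L1 l :
  ('N[lebesgue_measure]_1 [(fun s : R => (pcontrol_fun u s ord0 l)%:E)])%E =
  (\sum_(n < (last_step u).+1) `|level u n ord0 l| * (knot u n.+1 - knot u n))%:E.
Proof.
rewrite Lnorm1 -sumEFin.
under eq_integral => s _.
  rewrite /= pcontrol_fun_norm -sumEFin.
  over.
rewrite ge0_integral_sum//=; last first.
  by move=> n; apply/measurable_EFinP; apply: measurable_funM.
apply: eq_bigr => n _.
under eq_integral => s _ do rewrite mulrC EFinM.
rewrite ge0_integralZl//; last by apply/measurable_EFinP.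
rewrite integral_indic// setIT EFinM; congr (_ * _)%E.
apply: (etrans (lebesgue_measure_itv `[knot u n, knot u n.+1[)).
rewrite /= lte_fin; case: ifPn => //; rewrite -leNgt => le_n.
have /andP/le_anti -> := conj le_n (@knot_le _ _ u n (ltn_ord n)).
by rewrite subrr.
Qed.
End Control.

(** * The propagator *)

Section Propagation.
Context {R : realType} {H : completeNormedModType R[i]}.
Variable dot : {dot H for @Num.conj R[i]}.
Hypothesis norm_dot : inner_product_norm dot.
Variables (p : nat) (A : linop H) (B : 'I_p -> linop H).
Variables (lambda : nat -> R) (phi : nat -> H) (k : R).
Hypothesis cond_i : condition_i dot A B.
Hypothesis cond_ii : condition_ii dot A lambda phi.
Hypothesis coupled : weakly_coupled dot A B lambda phi k.

Let phi_basis : hilbert_basis dot phi. Proof. by case: cond_ii. Qed.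
Local Notation cf := (fcoef dot phi).
Local Notation c_k := (coupling_constant dot B lambda phi k).
Local Notation ev j := (lambda j `^ k).
Local Notation hdom := (dom_abspow dot lambda phi (k / 2)).
Local Notation hnorm := (norm_s dot lambda phi (k / 2)).

Lemma half_pow j : (lambda j `^ (k / 2)) ^+ 2 = ev j.
Proof. by rewrite -powR_mulrn ?powR_ge0// -powRrM divfK. Qed.

Lemma hnorm_ge0 x : 0 <= hnorm x. Proof. exact: rnorm_ge0. Qed.

Lemma yosida_norm_s e x : 0 < e -> hdom x ->
  rip dot (diag dot phi (yosida lambda k e) x) x <= hnorm x ^+ 2.
Proof.
move=> e0 /(dom_abspowP dot)[M xM].
rewrite /norm_s (rnorm_sqr norm_dot); apply: (rip_coef_le norm_dot phi_basis) => j.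
rewrite abspowE (fcoef_diag_dom norm_dot phi_basis xM).
rewrite (fcoef_diag norm_dot phi_basis (yosida_bound _ _ e0)).
rewrite Re_conjcZ !Re_conjcM normsqZ half_pow.
by rewrite ler_wpM2r ?normsq_ge0// yosida_le.
Qed.

Lemma yosida_partial e x n : 0 < e ->
  \sum_(0 <= j < n) yosida lambda k e j * normsq (cf x j) <=
  rip dot (diag dot phi (yosida lambda k e) x) x.
Proof.
move=> e0; set N := diag _ _ _ _.
have term j : complex.Re (conjc (cf N j) * cf x j) =
    yosida lambda k e j * normsq (cf x j).
  rewrite (fcoef_diag norm_dot phi_basis (yosida_bound _ _ e0)).
  by rewrite Re_conjcZ Re_conjcM.
apply: (@le_trans _ _ (rip dot (comb phi (cf N) n) x)).
  rewrite rip_comb le_eqVlt; apply/orP; left.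
  by apply/eqP/eq_bigr => j _; rewrite term.
apply: (rip_coef_le norm_dot phi_basis) => j.
rewrite (fcoef_comb phi_basis); case: ifP => // _.
by rewrite raddf0 mul0r term mulr_ge0 ?yosida_ge0 ?normsq_ge0.
Qed.

(** For a fixed number n of coefficients the regularized energy tends to the true
    one as e tends to 0, so the bound of [energy_step], uniform in e, gives a
    bound on the partial sums that is uniform in n. Finiteness of the norm and
    the estimate follow together. *)
Lemma group_step v U x t : unitary_group U -> generator U = controlled A B v ->
  0 <= t -> hdom x ->
  hdom (U t x) /\
  hnorm (U t x) <= expR (c_k * (\sum_(l < p) `|v ord0 l|) * t) * hnorm x.
Proof.
move=> gU UE t0 xdom; set a := c_k * _.
pose M := (expR (a * t) * hnorm x) ^+ 2.
have key n :
    \sum_(0 <= j < n) (lambda j `^ (k / 2)) ^+ 2 * normsq (cf (U t x) j) <= M.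
  set y := U t x.
  pose D := \sum_(0 <= j < n) ev j ^+ 2 * normsq (cf y j).
  have D0 : 0 <= D.
    by apply: sumr_ge0 => j _; rewrite mulr_ge0 ?normsq_ge0 ?sqr_ge0.
  (* D bounds the error because ev - yosida e <= e * ev ^+ 2 *)
  have approx e : 0 < e -> \sum_(0 <= j < n) ev j * normsq (cf y j) <= M + e * D.
    move=> e0; rewrite -lerBlDr.
    apply: (@le_trans _ _ (\sum_(0 <= j < n) yosida lambda k e j * normsq (cf y j))).
      rewrite mulr_sumr -sumrB; apply: ler_sum => j _.
      by rewrite mulrA -mulrBl ler_wpM2r ?normsq_ge0// yosida_lower.
    apply: le_trans (yosida_partial _ _ e0) _.
    apply: le_trans (energy_step norm_dot cond_i cond_ii coupled e0 x gU UE t0) _.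
    rewrite /M exprMn -/a; have -> : 2 * a * t = a * t + a * t by ring.
    by rewrite expRD -expr2 ler_wpM2l ?sqr_ge0// yosida_norm_s.
  under eq_bigr do rewrite half_pow.
  apply/ler_addgt0Pr => e e0.
  have D1 : 0 < D + 1 by rewrite ltr_wpDl.
  apply: le_trans (approx (e / (D + 1)) (divr_gt0 e0 D1)) _.
  by rewrite lerD2l mulrAC ler_pdivrMr// ler_pM2l// lerDl.
split; first by apply/(dom_abspowP dot); exists M.
rewrite -(@ler_pXn2r _ 2) ?nnegrE ?mulr_ge0 ?hnorm_ge0 ?expR_ge0//.
exact: (norm_s_le norm_dot phi_basis key).
Qed.

Lemma op_exp_step v x t : 0 <= t -> hdom x ->
  hdom (op_exp (controlled A B v) t x) /\
  hnorm (op_exp (controlled A B v) t x) <=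
    expR (c_k * (\sum_(l < p) `|v ord0 l|) * t) * hnorm x.
Proof.
move=> t0 xdom; rewrite /op_exp; set P := [set U | _].
have [[U PU]|nP] := pselect (exists U, P U).
  have [gU UE] := xgetPex ((fun _ y => y) : R -> H -> H) (ex_intro _ U PU).
  exact: group_step.
(* without such a group, [op_exp] is by definition the identity *)
rewrite xgetPN => [|U PU]; last by apply: nP; exists U.
split=> //; rewrite ler_peMl ?hnorm_ge0// -expR0 ler_expR.
by rewrite !mulr_ge0 ?(coupling_constant_ge0 dot) ?sumr_ge0.
Qed.

Lemma propagator_steps_bound (u : pcontrol R p) T n x : hdom x ->
  (n <= (last_step u).+1)%N ->
  hdom (propagator_steps A B u T n x) /\
  hnorm (propagator_steps A B u T n x) <=
    expR (c_k * \sum_(0 <= m < n) (\sum_(l < p) `|level u m ord0 l|) *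
       (knot u m.+1 - knot u m)) * hnorm x.
Proof.
move=> xdom; elim: n => [|n IH] nN /=.
  by rewrite big_geq// mulr0 expR0 mul1r.
have [ydom yle] := IH (ltnW nN).
have knots : knot u n <= knot u n.+1 by apply: knot_le.
set dt := Num.min T (knot u n.+1) - Num.min T (knot u n).
have dt0 : 0 <= dt.
  by rewrite subr_ge0; case: (leP T (knot u n.+1)); case: (leP T (knot u n)); lra.
have dtle : dt <= knot u n.+1 - knot u n.
  by rewrite /dt; case: (leP T (knot u n.+1)); case: (leP T (knot u n)); lra.
have [zdom zle] := op_exp_step (level u n) dt0 ydom.
split=> //; apply: le_trans zle _.
rewrite big_nat_recr//= [in leRHS]mulrDr expRD [X in _ <= X * _]mulrC -[leRHS]mulrA.
apply: (ler_pM (expR_ge0 _) (hnorm_ge0 _) _ yle); rewrite ler_expR mulrA ler_wpM2l//.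
by rewrite mulr_ge0 ?(coupling_constant_ge0 dot) ?sumr_ge0.
Qed.
End Propagation.

Theorem proposition2 (R : realType) (H : completeNormedModType R[i])
  (dot : {dot H for @Num.conj R[i]})
  (norm_dot : inner_product_norm dot)
  (sepH : separable H)
  (p : nat) (A : linop H) (B : 'I_p -> linop H)
  (lambda : nat -> R) (phi : nat -> H)
  (k : R) (k_gt0 : 0 < k)
  (cond_i : condition_i dot A B)
  (cond_ii : condition_ii dot A lambda phi)
  (coupled : weakly_coupled dot A B lambda phi k)
  (psi0 : H) (psi0_dom : dom_abspow dot lambda phi (k / 2) psi0)
  (K : R) (K_gt0 : 0 < K) (T : R) (T_ge0 : 0 <= T)
  (u : pcontrol R p)
  (u_L1 : (\sum_(l < p) 'N[lebesgue_measure]_1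
            [(fun s : R => (pcontrol_fun u s ord0 l)%:E)] <= K%:E)%E) :
  dom_abspow dot lambda phi (k / 2) (propagator A B u T psi0) /\
  norm_s dot lambda phi (k / 2) (propagator A B u T psi0) <=
  expR (coupling_constant dot B lambda phi k * K) *
  norm_s dot lambda phi (k / 2) psi0.
Proof.
have [sdom sle] := propagator_steps_bound norm_dot cond_i cond_ii coupled T psi0_dom
  (leqnn (last_step u).+1).
have dt0 : 0 <= T - Num.min T (knot u (last_step u).+1).
  by rewrite subr_ge0 ge_min lexx.
have [pdom ple] := op_exp_step norm_dot cond_i cond_ii coupled 0 dt0 sdom.
split=> //; apply: le_trans ple _.
(* after the last step the control is 0 and the norm does not grow *)
rewrite big1 => [|l _]; last by rewrite mxE normr0.
rewrite mulr0 mul0r expR0 mul1r; apply: le_trans sle _.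
rewrite ler_wpM2r ?rnorm_ge0// ler_expR ler_wpM2l ?(coupling_constant_ge0 dot)//.
rewrite -lee_fin; apply: le_trans u_L1.
under [leRHS]eq_bigr do rewrite pcontrol_L1.
rewrite sumEFin lee_fin big_mkord exchange_big/= le_eqVlt; apply/orP; left.
by apply/eqP/eq_bigr => n _; rewrite mulr_suml.
Qed.
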